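(* Let $\mathcal N$ be a network of timed automata, let $q\in Q$ be a global state, let $u\in\Sigma^*$ be a sequence of actions and let $Z$ be a time-elapsed global zone. Let $\mathsf Z=\operatorname{local-elapse}(\mathrm{local}(Z))$. If there is a local zone path $(q,\mathsf Z)\Rightarrow^u(q',\mathsf Z')$ in the local zone graph, then $$MZ(q,Z,u)=\mathrm{global}(\operatorname{sync}(\mathsf Z')),$$ where $MZ(q,Z,u)=\{v' \mid \exists v\in Z,\ \exists w\in\Sigma^* \text{ with } w\sim u \text{ and } (q,v)\xrightarrow{w}(q',v')\}$ (with $q'$ the target state of the local zone path). Otherwise (if there is no such local zone path on $u$ from $(q,\mathsf Z)$), $MZ(q,Z,u)=\emptyset$.
   Context: Network: $\mathcal N=\langle A_1,\dots,A_k\rangle$, each $A_p=(Q_p,\Sigma_p,X_p,q^{init}_p,T_p)$ with finite state set $Q_p$, finite alphabet $\Sigma_p$, finite clock set $X_p$, initial state $q^{init}_p$, and transitions $T_p\subseteq\Sigma_p\times Q_p\times\Phi(X_p)\times 2^{X_p}\times Q_p$, where $\Phi(X_p)$ consists of finite conjunctions of atoms $x\sim c$ ($x\in X_p$, $c\in\mathbb N$, $\sim\in\{<,\le,=,\ge,>\}$). The $Q_p$ are pairwise disjoint and the $X_p$ are pairwise disjoint. $Q=\prod_pQ_p$ ($q(p)$ denotes the $p$-th component), $\Sigma=\bigcup_p\Sigma_p$, $X=\bigcup_pX_p$, $\mathrm{dom}(b)=\{p:b\in\Sigma_p\}$. A $b$-transition of $p$ is an element of $T_p$ with first component $b$. Global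 semantics: for each clock $x$ there is an offset variable $\tilde x$; $\tilde X_p=\{\tilde x:x\in X_p\}$, $\tilde X=\bigcup_p\tilde X_p$. A global valuation is $v:\tilde X\cup\{t\}\to\mathbb R_{\ge0}$ with $v(t)\ge v(\tilde x)$ for all $\tilde x$; the value of clock $x$ is $v(t)-v(\tilde x)$ and $v\models g$ means every atom of $g$ holds for these values. $v+\delta$ adds $\delta$ to $v(t)$ only; $[R]v$ (for $R\subseteq X$) sets $\tilde x$ to $v(t)$ for $x\in R$ and keeps everything else. Steps: $(q,v)\xrightarrow{\delta}(q,v+\delta)$ for $\delta\ge0$; $(q,v)\xrightarrow{b}(q',v')$ if there are $b$-transitions $(b,q_p,g_p,R_p,q'_p)\in T_p$ for each $p\in\mathrm{dom}(b)$ with $q_p=q(p)$, $q'_p=q'(p)$ for $p\in\mathrm{dom}(b)$, $q'(p)=q(p)$ for $p\notin\mathrm{dom}(b)$, $v\models g_p$ for all $p\in\mathrm{dom}(b)$, and $v'=[\bigcup_{p\in\mathrm{dom}(b)}R_p]v$. For $u=b_1\cdots b_n$, $(q_0,v_0)\xrightarrow{u}(q_n,v_n')$ means there are $\delta_0,\dots,\delta_n\ge0$ with $(q_0,v_0)\xrightarrow{\delta_0}\xrightarrow{b_1}\xrightarrow{\delta_1}\cdots\xrightarrow{b_n}\xrightarrow{\delta_n}(q_n,v_n')$. Equivalence: $u\sim w$ if one word is obtained from the other by repeatedly swapping adjacent actions $a,b$ with $\mathrm{dom}(a)\cap\mathrm{dom}(b)=\emptyset$. Local semantics: each process $p$ has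 a reference clock $t_p$. A local valuation is $\nu:\tilde X\cup\{t_1,\dots,t_k\}\to\mathbb R_{\ge0}$ with $\nu(t_p)\ge\nu(\tilde x)$ for every $p$ and $\tilde x\in\tilde X_p$; the value of $x\in X_p$ is $\nu(t_p)-\nu(\tilde x)$, and $\nu\models g$ is defined accordingly. $[R]\nu$ keeps all $t_p$, sets $\tilde x$ to $\nu(t_p)$ for $x\in R\cap X_p$, and keeps other offsets. $\nu+_p\delta$ adds $\delta$ to $\nu(t_p)$ only. $\nu$ is synchronized if $\nu(t_1)=\dots=\nu(t_k)$; then $\mathrm{global}(\nu)$ is the global valuation with the same offsets and $t$ equal to this common value. For a global valuation $v$, $\mathrm{local}(v)$ has the same offsets and $t_p=v(t)$ for all $p$. Zones: a global zone is a set of global valuations defined by a finite conjunction of constraints $y_1-y_2\triangleleft c$ with $y_1,y_2\in\tilde X\cup\{t\}$, $\triangleleft\in\{<,\le\}$, $c\in\mathbb Z$; it is time-elapsed if $Z=\{v+\delta:v\in Z,\delta\ge0\}$. A local zone is a set of local valuations defined by such constraints over $\tilde X\cup\{t_1,\dots,t_k\}$. For a local zone $\mathsf Z$: $\operatorname{local-elapse}(\mathsf Z)=\{\nu+_1\delta_1+_2\cdots+_k\delta_k:\nu\in\mathsf Z,\delta_i\ge0\}$; $\operatorname{sync}(\mathsf Z)$ is the set of synchronized valuations in $\mathsf Z$; $\mathrm{global}(\operatorname{sync}(\mathsf Z))=\{\mathrm{global}(\nu):\nu\in\operatorname{sync}(\mathsf Z)\}$; for a global zone $Z$, $\mathrm{local}(Z)=\{\mathrm{local}(v):v\in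 Z\}$. Local zone step: for an action $b$ and a choice of $b$-transitions $(b,q_p,g_p,R_p,q'_p)\in T_p$, $p\in\mathrm{dom}(b)$, with $q(p)=q_p$, $q'(p)=q'_p$ for $p\in\mathrm{dom}(b)$ and $q'(p)=q(p)$ otherwise, $(q,\mathsf Z)\Rightarrow_b(q',\mathsf Z')$ where $\mathsf Z'=\operatorname{local-elapse}([R](\mathsf Z\cap\mathsf Z_g\cap\mathsf Z_{sync}))$, $R=\bigcup_{p\in\mathrm{dom}(b)}R_p$, $\mathsf Z_g=\{\nu:\nu\models g_p\ \forall p\in\mathrm{dom}(b)\}$, $\mathsf Z_{sync}=\{\nu:\nu(t_{p_1})=\nu(t_{p_2})\ \forall p_1,p_2\in\mathrm{dom}(b)\}$, and $[R]\mathsf Z=\{[R]\nu:\nu\in\mathsf Z\}$. For a word $u$, $(q,\mathsf Z)\Rightarrow^u(q',\mathsf Z')$ denotes a sequence of such steps along the letters of $u$.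
   Formalization: With two b-transitions of different guards between the same states, the first claim fails as the final local zone depends on the transitions chosen; it is stated for deterministic networks, and for all networks MZ is the union of global(sync(Z')) over all local zone paths on u to q'. *)

(* Defs.v *)
From HB Require Import structures.
From mathcomp Require Import all_boot all_order all_algebra.
From mathcomp Require Import boolp classical_sets reals.

Set Implicit Arguments.
Unset Strict Implicit.
Unset Printing Implicit Defensive.

Import Order.TTheory GRing.Theory Num.Theory.

Local Open Scope classical_set_scope.
Local Open Scope ring_scope.

Inductive cmp := CLt | CLe | CEq | CGe | CGt.

Record atom (X : Type) := Atom { atom_clock : X; atom_cmp : cmp; atom_cst : nat }.

(* A guard is the conjunction of the atoms of the list. *)
Definition guard (X : Type) := seq (atom X).

Record transition (Act Q X : finType) := Transition {
  tr_act : Act;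
  tr_src : Q;
  tr_guard : guard X;
  tr_reset : {set X};
  tr_tgt : Q }.

(* [Act] is a common finite universe of action names, so that distinct
   automata may share actions; the alphabet of an automaton is a subset of it. *)
Record timed_automaton (Act : finType) := TimedAutomaton {
  ta_state : finType;
  ta_alph : {set Act};
  ta_clock : finType;
  ta_init : ta_state;
  ta_trans : set (transition Act ta_state ta_clock);
  ta_trans_act : forall e, ta_trans e -> tr_act e \in ta_alph }.

Definition network (Act : finType) (k : nat) := 'I_k -> timed_automaton Act.

Section Network.
Variables (R : realType) (Act : finType) (k : nat) (N : network Act k).

Definition gstate := forall p : 'I_k, ta_state (N p).

Definition alphabet : {set Act} := (\bigcup_(p < k) ta_alph (N p))%SET.

Definition dom (b : Act) : {set 'I_k} := [set p | b \in ta_alph (N p)]%SET.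

(* The tag makes the clock sets of the processes pairwise disjoint. *)
Definition clock := {p : 'I_k & ta_clock (N p)}.

Definition clk (p : 'I_k) (x : ta_clock (N p)) : clock :=
  Tagged (fun p => ta_clock (N p)) x.

Definition word_in_alphabet (u : seq Act) := forall b, b \in u -> b \in alphabet.

Inductive trace_equiv (u : seq Act) : seq Act -> Prop :=
| trace_refl : trace_equiv u u
| trace_swap w1 a b w2 :
    trace_equiv u (w1 ++ a :: b :: w2) -> (dom a :&: dom b = finset.set0)%SET ->
    trace_equiv u (w1 ++ b :: a :: w2).

(* Only the values at the processes of [dom b] matter, here and below: the
   types [transition _ _ _] are inhabited as soon as there is an action, so
   quantifying over total families is harmless. *)
Definition trans_family :=
  forall p : 'I_k, transition Act (ta_state (N p)) (ta_clock (N p)).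

Definition discrete_step (b : Act) (e : trans_family) (q q' : gstate) :=
  (forall p, p \in dom b ->
     [/\ ta_trans (e p), tr_act (e p) = b, tr_src (e p) = q p
       & tr_tgt (e p) = q' p]) /\
  (forall p, p \notin dom b -> q' p = q p).

Definition resets (b : Act) (e : trans_family) : {set clock} :=
  [set x : clock | (tag x \in dom b) && (tagged x \in tr_reset (e (tag x)))]%SET.

Definition sat_atom (X : Type) (val : X -> R) (a : atom X) : bool :=
  let x := val (atom_clock a) in
  let c := (atom_cst a)%:R in
  match atom_cmp a with
  | CLt => x < c
  | CLe => x <= c
  | CEq => x == c
  | CGe => c <= x
  | CGt => c < x
  end.

Definition sat_guard (X : Type) (val : X -> R) (g : guard X) : bool :=
  all (sat_atom val) g.

(* [dconstr y1 y2 s c] is y1 - y2 < c if [s] is true and y1 - y2 <= c otherwise. *)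
Record dconstr (V : Type) := DConstr {
  dc_fst : V; dc_snd : V; dc_strict : bool; dc_cst : int }.

Definition sat_dconstr (V : Type) (v : V -> R) (c : dconstr V) : bool :=
  let d := v (dc_fst c) - v (dc_snd c) in
  if dc_strict c then d < (dc_cst c)%:~R else d <= (dc_cst c)%:~R.

(* Global semantics.  [GOff x] is the offset variable of the clock x and [GRef]
   is t.  Elements of [gval] are arbitrary maps; the side conditions of global
   valuations are in [is_gval], which delays and actions preserve. *)
Inductive gvar := GOff of clock | GRef.

Definition gval := gvar -> R.

Definition is_gval (v : gval) :=
  (forall y, 0 <= v y) /\ (forall x, v (GOff x) <= v GRef).

Definition gclock (v : gval) (x : clock) : R := v GRef - v (GOff x).

Definition gsat (v : gval) (p : 'I_k) (g : guard (ta_clock (N p))) : bool :=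
  sat_guard (fun x => gclock v (clk x)) g.

Definition gdelay (v : gval) (d : R) : gval :=
  fun y => match y with GOff x => v (GOff x) | GRef => v GRef + d end.

Definition greset (D : {set clock}) (v : gval) : gval :=
  fun y => match y with
           | GOff x => if x \in D then v GRef else v (GOff x)
           | GRef => v GRef
           end.

Definition gstep (b : Act) (q : gstate) (v : gval) (q' : gstate) (v' : gval) :=
  exists e : trans_family,
    [/\ discrete_step b e q q',
        forall p, p \in dom b -> gsat v (tr_guard (e p))
      & v' = greset (resets b e) v].

Fixpoint grun (q : gstate) (v : gval) (u : seq Act) (q' : gstate) (v' : gval) :=
  if u is b :: u1 then
    exists (d : R) (q1 : gstate) (v1 : gval),
      [/\ 0 <= d, gstep b q (gdelay v d) q1 v1 & grun q1 v1 u1 q' v']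
  else exists d : R, [/\ 0 <= d, q' = q & v' = gdelay v d].

Definition is_gzone (Z : set gval) :=
  exists cs : seq (dconstr gvar),
    Z = [set v | is_gval v /\ all (sat_dconstr v) cs].

Definition time_elapsed (Z : set gval) :=
  Z = [set w | exists v d, [/\ Z v, 0 <= d & w = gdelay v d]].

(* The values reached at the global state q'. *)
Definition MZ (q : gstate) (Z : set gval) (u : seq Act) (q' : gstate) :
    set gval :=
  [set v' | exists v w,
     [/\ Z v, word_in_alphabet w, trace_equiv u w & grun q v w q' v']].

(* Local semantics.  [LRef p] is the reference clock t_p.  Every local valuation
   below is obtained from a global one by [local_of], delays and resets, so it is
   nonnegative and satisfies [nu (LOff x) <= nu (LRef p)] for the clocks x of p. *)
Inductive lvar := LOff of clock | LRef of 'I_k.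

Definition lval := lvar -> R.

Definition lclock (nu : lval) (x : clock) : R := nu (LRef (tag x)) - nu (LOff x).

Definition lsat (nu : lval) (p : 'I_k) (g : guard (ta_clock (N p))) : bool :=
  sat_guard (fun x => lclock nu (clk x)) g.

(* nu +_1 d 1 +_2 ... +_k d k *)
Definition ldelay (nu : lval) (d : 'I_k -> R) : lval :=
  fun y => match y with
           | LOff x => nu (LOff x)
           | LRef p => nu (LRef p) + d p
           end.

Definition lreset (D : {set clock}) (nu : lval) : lval :=
  fun y => match y with
           | LOff x => if x \in D then nu (LRef (tag x)) else nu (LOff x)
           | LRef p => nu (LRef p)
           end.

Definition local_elapse (Z : set lval) : set lval :=
  [set mu | exists nu d, [/\ Z nu, forall p, 0 <= d p & mu = ldelay nu d]].

Definition synchronized (nu : lval) := forall p1 p2, nu (LRef p1) = nu (LRef p2).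

Definition sync (Z : set lval) : set lval := Z `&` [set nu | synchronized nu].

(* v = global(nu), for synchronized nu; for 0 < k this determines v. *)
Definition is_global_of (nu : lval) (v : gval) :=
  (forall x, v (GOff x) = nu (LOff x)) /\ (forall p, v GRef = nu (LRef p)).

Definition global_set (S : set lval) : set gval :=
  [set v | exists2 nu, S nu & is_global_of nu v].

Definition local_of (v : gval) : lval :=
  fun y => match y with LOff x => v (GOff x) | LRef _ => v GRef end.

Definition local_set (Z : set gval) : set lval := [set local_of v | v in Z].

Definition zone_guard (b : Act) (e : trans_family) : set lval :=
  [set nu | forall p, p \in dom b -> lsat nu (tr_guard (e p))].

Definition zone_sync (b : Act) : set lval :=
  [set nu | forall p1 p2, p1 \in dom b -> p2 \in dom b ->
     nu (LRef p1) = nu (LRef p2)].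

Definition zstep (b : Act) (q : gstate) (Z : set lval)
    (q' : gstate) (Z' : set lval) :=
  exists e : trans_family,
    discrete_step b e q q' /\
    Z' = local_elapse
           [set lreset (resets b e) nu
           | nu in Z `&` zone_guard b e `&` zone_sync b].

Fixpoint zpath (q : gstate) (Z : set lval) (u : seq Act)
    (q' : gstate) (Z' : set lval) :=
  if u is b :: u1 then
    exists (q1 : gstate) (Z1 : set lval),
      zstep b q Z q1 Z1 /\ zpath q1 Z1 u1 q' Z'
  else q' = q /\ Z' = Z.

(* In a deterministic network a word and a starting node determine the local
   zone path.  Otherwise several paths on u may end in the same q' with distinct
   zones (take two b-transitions with the same source and target and the guards
   x < 1 and x > 2); [MZ], which only depends on u and q', then collects the runs
   of all these paths. *)
Definition deterministic :=
  forall (p : 'I_k) (e1 e2 : transition Act (ta_state (N p)) (ta_clock (N p))),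
    ta_trans e1 -> ta_trans e2 ->
    tr_act e1 = tr_act e2 -> tr_src e1 = tr_src e2 -> e1 = e2.

End Network.

(* Main.v *)
Require Import Defs.
From HB Require Import structures.
From mathcomp Require Import all_boot all_order all_algebra.
From mathcomp Require Import boolp classical_sets reals.

Set Implicit Arguments.
Unset Strict Implicit.
Unset Printing Implicit Defensive.

Import Order.TTheory GRing.Theory Num.Theory.

Local Open Scope classical_set_scope.
Local Open Scope ring_scope.

(** Delays in a local zone path can be postponed: it is enough that a process
    lets its reference clock advance just before it takes part in an action.  A
    local run then carries no delays, only a timestamp for each action, which is
    the common value of the reference clocks of the processes involved.  In such
    lazy runs adjacent independent actions commute.  Two adjacent actions with
    decreasing timestamps have disjoint domains, so insertion sort turns every
    lazy run on [u] into one on some [w ~ u] with nondecreasing timestamps, and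
    the latter is exactly a global run, up to letting the processes catch up with
    global time. *)

Section LazyRuns.
Variables (R : realType) (Act : finType) (k : nat) (N : network Act k).

Implicit Types (q : gstate N) (nu mu : lval R N) (v : gval R N).
Implicit Types (a b : Act) (u w : seq Act) (l : seq (R * Act)).

(** * Trace equivalence and domains of actions *)

Lemma trace_equiv_trans u w z :
  trace_equiv N u w -> trace_equiv N w z -> trace_equiv N u z.
Proof. by move=> uw; elim=> // w1 a b w2 _; exact: trace_swap. Qed.

Lemma trace_equiv_cons a u w :
  trace_equiv N u w -> trace_equiv N (a :: u) (a :: w).
Proof.
elim=> [|w1 b c w2 _ IH dis]; first exact: trace_refl.
by rewrite -cat_cons; apply: trace_swap.
Qed.

Lemma trace_equiv_mem u w : trace_equiv N u w -> w =i u.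
Proof.
elim=> // w1 a b w2 _ IH _ x.
by rewrite -IH !mem_cat !inE; congr orb; rewrite orbCA.
Qed.

Lemma dom_disjoint a b :
  (dom N a :&: dom N b = finset.set0)%SET ->
  forall p, p \in dom N a -> p \notin dom N b.
Proof.
move=> dis p pa; apply/negP => pb.
by have := finset.in_set0 p; rewrite -dis finset.in_setI pa pb.
Qed.

Lemma dom_gt0 b : b \in alphabet N -> exists p, p \in dom N b.
Proof. by move=> /bigcupP[p _ bp]; exists p; rewrite inE. Qed.

(** * Lazy runs and the commutation of independent actions *)

Definition fire b (e : trans_family N) (t : R) nu : lval R N :=
  fun y => match y with
           | LOff x => if x \in resets b e then t else nu (LOff x)
           | LRef p => if p \in dom N b then t else nu (LRef N p)
           end.

(** The inequality makes the implicit delay of each participant nonnegative; guards are read at time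
    [t], before the resets. *)
Definition fireable b (e : trans_family N) (t : R) nu :=
  forall p, p \in dom N b ->
    nu (LRef N p) <= t /\
    sat_guard (fun x => t - nu (LOff (clk x))) (tr_guard (e p)).

Fixpoint lazy_run q nu l q' nu' :=
  if l is (t, b) :: l1 then
    exists (e : trans_family N) q1,
      [/\ discrete_step b e q q1, fireable b e t nu
        & lazy_run q1 (fire b e t nu) l1 q' nu']
  else q' = q /\ nu' = nu.

Lemma in_resets b (e : trans_family N) (x : clock N) :
  (x \in resets b e) =
  (tag x \in dom N b) && (tagged x \in tr_reset (e (tag x))).
Proof. by rewrite inE. Qed.

Lemma notin_resets b (e : trans_family N) (x : clock N) :
  tag x \notin dom N b -> (x \in resets b e) = false.
Proof. by move=> nx; rewrite in_resets (negbTE nx). Qed.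

(** Each action writes its own timestamp, and only into variables of its own processes, so
    independent actions write into disjoint sets of variables. *)
Lemma fire_comm a b ea eb ta tb nu :
  (dom N a :&: dom N b = finset.set0)%SET ->
  fire b eb tb (fire a ea ta nu) = fire a ea ta (fire b eb tb nu).
Proof.
move=> /dom_disjoint dis; apply/funext => -[x|p] /=.
  rewrite !in_resets; case: (boolP (tag x \in dom N a)) => //= xa.
  by rewrite (negbTE (dis _ xa)).
by case: (boolP (p \in dom N a)) => // /dis /negbTE ->.
Qed.

Lemma fireable_fire a b ea eb ta tb nu :
  (dom N a :&: dom N b = finset.set0)%SET ->
  fireable b eb tb (fire a ea ta nu) <-> fireable b eb tb nu.
Proof.
move=> /dom_disjoint dis.
have out p : p \in dom N b -> p \notin dom N a.
  by apply: contraL; exact: dis.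
have off p : p \in dom N b ->
    (fun x => tb - fire a ea ta nu (LOff (clk x))) =
    (fun x : ta_clock (N p) => tb - nu (LOff (clk x))).
  by move=> pb; apply/funext => x /=; rewrite notin_resets//; exact: out.
by split=> H p pb; have := H p pb; rewrite (off _ pb)/= (negbTE (out _ pb)).
Qed.

Lemma discrete_step_swap a b ea eb q q1 q2 :
  (dom N a :&: dom N b = finset.set0)%SET ->
  discrete_step a ea q q1 -> discrete_step b eb q1 q2 ->
  exists2 q3, discrete_step b eb q q3 & discrete_step a ea q3 q2.
Proof.
move=> /dom_disjoint dis [a1 a2] [b1 b2].
have out p : p \in dom N b -> p \notin dom N a.
  by apply: contraL; exact: dis.
(* In the new intermediate state only the processes of [b] have moved; they are already at their
   final place, since [a] does not touch them. *)
exists (fun p => if p \in dom N b then q2 p else q p); split=> p pd.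
- by have [? ? -> ->] := b1 p pd; rewrite pd a2 // out.
- by rewrite (negbTE pd).
- have [? ? -> ->] := a1 p pd.
  by rewrite (negbTE (dis _ pd)) b2 // dis.
- by case: ifPn => // pb; rewrite b2 // a2.
Qed.

Lemma lazy_run_swap q nu l1 ta a tb b l2 q' nu' :
  (dom N a :&: dom N b = finset.set0)%SET ->
  lazy_run q nu (l1 ++ (ta, a) :: (tb, b) :: l2) q' nu' ->
  lazy_run q nu (l1 ++ (tb, b) :: (ta, a) :: l2) q' nu'.
Proof.
move=> dis; elim: l1 q nu => [|[t c] l1 IH] q nu /=; last first.
  by move=> [e [q1 [? ? /IH ?]]]; exists e, q1.
move=> [ea [q1 [sa fa [eb [q2 [sb fb run]]]]]].
have [q3 sb' sa'] := discrete_step_swap dis sa sb.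
have dis' : (dom N b :&: dom N a = finset.set0)%SET by rewrite finset.setIC.
exists eb, q3; split=> //; first by move: fb => /(fireable_fire _ _ _ _ _ dis).
exists ea, q2; split=> //; first by apply/fireable_fire.
by rewrite -fire_comm.
Qed.

(** The swaps leading from [u] to [w] are undone one at a time, last one first. Each entry keeps its
    timestamp, so the times along the result need not be ordered. *)
Lemma lazy_run_trace_equiv u w q nu l q' nu' :
  trace_equiv N u w -> map snd l = w -> lazy_run q nu l q' nu' ->
  exists2 l', map snd l' = u & lazy_run q nu l' q' nu'.
Proof.
move=> uw; elim: uw l => [|w1 a b w2 _ IH dis] l lw run; first by exists l.
have [l1 [[tb b'] [[ta a'] [l2 [El]]]]] :
    exists l1 x y l2, l = l1 ++ x :: y :: l2 /\
      (map snd l1, x.2, y.2, map snd l2) = (w1, b, a, w2).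
  elim: w1 l lw {IH run} => [|c w1 IH] [|x l] //= [].
    by move: l => [|y l] // <- [<- <-]; exists [::], x, y, l.
  move=> <- /IH[l1 [y [z [l2 [-> [<- <- <- <-]]]]]].
  by exists (x :: l1), y, z, l2.
case=> /= lw1 eb ea lw2; subst b' a'.
apply: (IH (l1 ++ (ta, a) :: (tb, b) :: l2)).
  by rewrite map_cat /= lw1 lw2.
by apply: lazy_run_swap; rewrite -?El // finset.setIC.
Qed.

(** * Bounds on timestamps and sorting by time *)

Lemma lazy_run_ref_le q nu l q' nu' p :
  lazy_run q nu l q' nu' -> nu (LRef N p) <= nu' (LRef N p).
Proof.
elim: l q nu => [|[t b] l IH] q nu /=; first by case=> _ ->.
move=> [e [q1 [_ f /IH]]] /=; case: ifPn => // pb; apply: le_trans.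
by have [] := f p pb.
Qed.

(** Letters of the alphabet have a participant, whose reference clock bounds the timestamp from
    below. *)
Lemma lazy_run_lower c q nu l q' nu' :
  word_in_alphabet N (map snd l) -> (forall p, c <= nu (LRef N p)) ->
  lazy_run q nu l q' nu' -> all (fun x => c <= x.1) l.
Proof.
elim: l q nu => [|[t b] l IH] q nu //= lin cnu [e [q1 [_ f run]]].
have ct : c <= t.
  have [p pb] := dom_gt0 (lin b (mem_head _ _)).
  by have [/(le_trans (cnu p))] := f p pb.
rewrite ct /=; apply: IH run => [x xl|p /=]; first by apply: lin; rewrite inE xl orbT.
by case: ifP.
Qed.

(** Firing sets a participant's reference clock to the timestamp, and that clock never decreases
    afterwards. *)
Lemma lazy_run_upper c q nu l q' nu' :
  word_in_alphabet N (map snd l) -> (forall p, nu' (LRef N p) <= c) ->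
  lazy_run q nu l q' nu' -> all (fun x => x.1 <= c) l.
Proof.
elim: l q nu => [|[t b] l IH] q nu //= lin cnu [e [q1 [_ f run]]].
apply/andP; split.
  have [p pb] := dom_gt0 (lin b (mem_head _ _)).
  by have := lazy_run_ref_le p run; rewrite /= pb => /le_trans; exact.
by apply: IH run => // x xl; apply: lin; rewrite inE xl orbT.
Qed.

Definition le_time : rel (R * Act) := fun x y => x.1 <= y.1.

Lemma le_time_trans : transitive le_time.
Proof. by move=> y x z; exact: le_trans. Qed.

(** The [perm_eq] clause serves the induction: it transfers the lower bound on the timestamps of the
    tail to the result of the recursive insertion. *)
Lemma lazy_run_insert x l q nu q' nu' :
  sorted le_time l -> lazy_run q nu (x :: l) q' nu' ->
  exists l', [/\ sorted le_time l', perm_eq l' (x :: l),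
    trace_equiv N (map snd (x :: l)) (map snd l') & lazy_run q nu l' q' nu'].
Proof.
elim: l q nu => [|y l IH] q nu.
  by move=> _ run; exists [:: x]; split=> //; exact: trace_refl.
move=> yl run; have [xy|yx] := boolP (le_time x y).
  by exists [:: x, y & l]; split; rewrite //= ?xy //; exact: trace_refl.
case: x y yx yl run IH => [tb b] [ta a]; rewrite /le_time /= -ltNge => yx yl run IH.
(* A shared process would stand at [tb] after [b], too late to fire [a] at the smaller time [ta]. *)
have dis : (dom N b :&: dom N a = finset.set0)%SET.
  apply/setP => p; rewrite finset.in_setI finset.in_set0; apply/negP => /andP[pb pa].
  move: run => [eb [q1 [_ _ [ea [q2 [_ fa _]]]]]].
  by have [] := fa p pa; rewrite /= pb leNgt yx.
have [ea [q1 [sa fa run1]]] := @lazy_run_swap _ _ [::] _ _ _ _ _ _ _ dis run.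
move: yl; rewrite (path_sortedE le_time_trans) => /andP[al sl].
have [l' [sl' pl' tl' run']] := IH _ _ sl run1.
exists ((ta, a) :: l'); split.
- rewrite /= (path_sortedE le_time_trans) sl' andbT (perm_all _ pl') /= al andbT.
  exact: ltW.
- rewrite -(perm_cons (ta, a)) in pl'; apply: (perm_trans pl').
  exact: (permEl (perm_catCA [:: (ta, a)] [:: (tb, b)] l)).
- apply: trace_equiv_trans (trace_equiv_cons a tl').
  exact: (@trace_swap _ _ _ _ [::] _ _ _ (trace_refl _ _)).
- by exists ea, q1.
Qed.

Lemma lazy_run_sort l q nu q' nu' :
  lazy_run q nu l q' nu' ->
  exists l', [/\ sorted le_time l', trace_equiv N (map snd l) (map snd l')
    & lazy_run q nu l' q' nu'].
Proof.
elim: l q nu => [|[t b] l IH] q nu.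
  by move=> run; exists [::]; split=> //; exact: trace_refl.
move=> [e [q1 [s f /IH[l1 [sl1 tl1 run1]]]]].
have [|l' [sl' _ tl' run']] := @lazy_run_insert (t, b) l1 q nu q' nu' sl1.
  by exists e, q1.
exists l'; split=> //.
by apply: trace_equiv_trans tl'; exact: trace_equiv_cons.
Qed.

(** * Lazy runs and global runs *)

Definition lags nu v :=
  (forall x, nu (LOff x) = v (GOff x)) /\ (forall p, nu (LRef N p) <= v (GRef N)).

Lemma lags_fire b (e : trans_family N) d nu v :
  0 <= d -> lags nu v ->
  lags (fire b e (v (GRef N) + d) nu) (greset (resets b e) (gdelay v d)).
Proof.
move=> d0 [off ref]; split=> [x|p] /=; first by case: ifP.
by case: ifP => // _; rewrite (le_trans (ref p)) // lerDl.
Qed.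

Lemma lags_sat d nu v p (g : guard (ta_clock (N p))) :
  lags nu v ->
  gsat (gdelay v d) g =
  sat_guard (fun x => v (GRef N) + d - nu (LOff (clk x))) g.
Proof.
move=> [off _]; rewrite /gsat; congr sat_guard.
by apply/funext => x; rewrite /gclock /= off.
Qed.

(** The timestamp of an action is the global time at which it occurs; processes not involved merely
    fall behind, which [lags] allows. *)
Lemma grun_lazy_run q v w q' v' nu :
  lags nu v -> grun q v w q' v' ->
  exists l nu', [/\ map snd l = w, lazy_run q nu l q' nu' & lags nu' v'].
Proof.
elim: w q v nu => [|b w IH] q v nu lag /=.
  move=> [d [d0 -> ->]]; exists [::], nu; split=> //.
  by split=> [|p] /=; [exact: lag.1|rewrite (le_trans (lag.2 p)) // lerDl].
move=> [d [q1 [v1 [d0 [e [s sat ->]] run]]]].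
have [l [nu' [<- lrun lag']]] := IH _ _ _ (lags_fire b e d0 lag) run.
exists ((v (GRef N) + d, b) :: l), nu'; split=> //.
exists e, q1; split=> // p pb; split; last by rewrite -lags_sat // sat.
by rewrite (le_trans (lag.2 p)) // lerDl.
Qed.

(** The global delay before an action is the gap to its timestamp, nonnegative because the times are
    sorted; a last delay reaches [T]. *)
Lemma lazy_run_grun T l q nu v q' nu' :
  lags nu v -> sorted le_time l -> all (fun x => v (GRef N) <= x.1) l ->
  all (fun x => x.1 <= T) l -> v (GRef N) <= T -> lazy_run q nu l q' nu' ->
  exists v', [/\ grun q v (map snd l) q' v', forall x, v' (GOff x) = nu' (LOff x)
    & v' (GRef N) = T].
Proof.
elim: l q nu v => [|[t b] l IH] q nu v lag.
  move=> _ _ _ vT [-> ->]; exists (gdelay v (T - v (GRef N))); split=> /=.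
  - by exists (T - v (GRef N)); rewrite subr_ge0.
  - by move=> x; rewrite lag.1.
  - by rewrite subrKC.
rewrite /= (path_sortedE le_time_trans).
move=> /andP[tl sl] /andP[vt _] /andP[tT lT] _ [e [q1 [s f run]]].
have d0 : 0 <= t - v (GRef N) by rewrite subr_ge0.
have := lags_fire b e d0 lag; rewrite subrKC => lag1.
case: (IH _ _ _ lag1 sl _ lT _ run) => [||v' [grun' off' ref']] /=.
- by rewrite subrKC.
- by rewrite subrKC.
exists v'; split=> //.
exists (t - v (GRef N)), q1, (greset (resets b e) (gdelay v (t - v (GRef N)))).
split=> //; exists e; split=> // p pb.
by rewrite (lags_sat _ _ lag) subrKC; case: (f p pb).
Qed.

(** * Lazy runs and local zone paths *)

Definition fire_set b (e : trans_family N) (S : set (lval R N)) : set (lval R N) :=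
  [set mu | exists nu t, [/\ S nu, fireable b e t nu & mu = fire b e t nu]].

(** Delays of processes outside [dom N b] commute with the action and merge into the later elapse;
    those of the participants are absorbed into the timestamp. *)
Lemma local_elapse_fire_set b (e : trans_family N) (S : set (lval R N)) :
  local_elapse [set lreset (resets b e) nu
               | nu in local_elapse S `&` zone_guard b e `&` zone_sync b] =
  local_elapse (fire_set b e S).
Proof.
apply/seteqP; split=> mu [nu [d [Snu d0 ->]]].
  case: Snu => nu1 [[[s [d1 [Ss d10 ->]]] sat syn] <-].
  have [t tE] : exists t, forall p, p \in dom N b -> s (LRef N p) + d1 p = t.
    have [[p pb]|no] := pselect (exists p, p \in dom N b).
      by exists (s (LRef N p) + d1 p) => p' pb'; exact: syn.
    (* If no process takes part in [b], any timestamp will do. *)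
    by exists 0 => p pb; case: no; exists p.
  exists (fire b e t s).
  exists (fun p => if p \in dom N b then d p else d1 p + d p); split.
  - exists s, t; split=> // p pb; split; first by rewrite -(tE p pb) lerDl.
    have := sat p pb; rewrite /lsat; congr (is_true (sat_guard _ _)).
    by apply/funext => x; rewrite /lclock /= tE.
  - by move=> p; case: ifP => // _; rewrite addr_ge0.
  - apply/funext => -[x|p] /=; last by case: ifPn => [/tE ->|]; rewrite ?addrA.
    by case: ifP => //; rewrite in_resets => /andP[/tE ->].
case: Snu => s [t [Ss f ->]].
pose d1 p := if p \in dom N b then t - s (LRef N p) else 0.
have d1E p : p \in dom N b -> s (LRef N p) + d1 p = t.
  by move=> pb; rewrite /d1 pb subrKC.
exists (lreset (resets b e) (ldelay s d1)), d; split=> //.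
- exists (ldelay s d1) => //; split; first split.
  + exists s, d1; split=> // p; rewrite /d1; case: ifP => // pb.
    by rewrite subr_ge0; case: (f p pb).
  + move=> p pb; have [_] := f p pb; rewrite /lsat; congr (is_true (sat_guard _ _)).
    by apply/funext => x; rewrite /lclock /= d1E.
  + by move=> p1 p2 p1b p2b; rewrite /= !d1E.
- apply/funext => -[x|p] /=.
    by case: ifP => //; rewrite in_resets => /andP[/d1E ->].
  by case: ifPn => [/d1E ->|pb] //; rewrite /d1 (negbTE pb) addr0.
Qed.

(** Every zone on the path is again the elapse of some set, [fire_set b e S] after one step, so the
    induction generalizes over [S]. *)
Lemma zpath_lazy_run u q (S : set (lval R N)) q' Z' mu :
  zpath q (local_elapse S) u q' Z' -> Z' mu ->
  exists nu l nu' d, [/\ S nu, map snd l = u, lazy_run q nu l q' nu',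
    forall p, 0 <= d p & mu = ldelay nu' d].
Proof.
elim: u q S => [|b u IH] q S /=.
  by move=> [-> ->] [nu [d [Snu d0 ->]]]; exists nu, [::], nu, d.
move=> [q1 [Z1 [[e [s ->]]]]]; rewrite local_elapse_fire_set => path Zmu.
have [nu1 [l [nu' [d [[nu [t [Snu f ->]]] <- run d0 ->]]]]] := IH _ _ path Zmu.
by exists nu, ((t, b) :: l), nu', d; split=> //; exists e, q1.
Qed.

Lemma lazy_run_zpath l q (S : set (lval R N)) nu q' nu' d :
  S nu -> lazy_run q nu l q' nu' -> (forall p, 0 <= d p) ->
  exists2 Z', zpath q (local_elapse S) (map snd l) q' Z' & Z' (ldelay nu' d).
Proof.
move=> + + d0; elim: l q S nu => [|[t b] l IH] q S nu Snu /=.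
  by move=> [-> ->]; exists (local_elapse S) => //; exists nu, d.
move=> [e [q1 [s f run]]].
have [|Z' path Zmu] := IH q1 (fire_set b e S) _ _ run; first by exists nu, t.
exists Z' => //; exists q1, (local_elapse (fire_set b e S)); split=> //.
by exists e; rewrite local_elapse_fire_set.
Qed.

Lemma MZ_zpath (p0 : 'I_k) q u (Z : set (gval R N)) q' :
  word_in_alphabet N u ->
  MZ q Z u q' =
  \bigcup_(Z' in [set Z' | zpath q (local_elapse (local_set Z)) u q' Z'])
    global_set (sync Z').
Proof.
move=> uin; apply/seteqP; split=> [v' [v [w [Zv _ uw run]]]|v' [Z' /= path]].
  have lag : lags (local_of v) v by split.
  have [l [nu' [lw lrun [off ref]]]] := grun_lazy_run lag run.
  have [l' l'u lrun'] := lazy_run_trace_equiv uw lw lrun.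
  (* These closing delays bring every process to the final global time, which synchronizes the
     valuation. *)
  have d0 p : 0 <= v' (GRef N) - nu' (LRef N p) by rewrite subr_ge0.
  have Sv : local_set Z (local_of v) by exists v.
  have [Z'] := lazy_run_zpath Sv lrun' d0; rewrite l'u => path Zmu.
  exists Z' => //; exists (ldelay nu' (fun p => v' (GRef N) - nu' (LRef N p))).
    by split=> // p1 p2 /=; rewrite !subrKC.
  by split=> [x|p] /=; rewrite ?off ?subrKC.
move=> [mu [Zmu _] [off ref]].
have [_ [l [nu' [d [[v Zv <-] lu run d0 Emu]]]]] := zpath_lazy_run path Zmu.
have [l' [sl' ll' run']] := lazy_run_sort run.
have l'in : word_in_alphabet N (map snd l').
  by move=> b; rewrite (trace_equiv_mem ll') lu; exact: uin.
have le_final p : nu' (LRef N p) <= v' (GRef N) by rewrite (ref p) Emu /= lerDl.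
have lag : lags (local_of v) v by split.
(* The initial and final global times are compared through the reference clock of [p0], which also
   covers the empty word. *)
have vT : v (GRef N) <= v' (GRef N).
  exact: le_trans (lazy_run_ref_le p0 run) (le_final p0).
have [] := lazy_run_grun lag sl' (lazy_run_lower l'in _ run')
  (lazy_run_upper l'in le_final run') vT run' => // w [grun' woff wref].
exists v, (map snd l'); split=> //; first by rewrite -lu.
suff -> : v' = w by [].
by apply/funext => -[x|]; rewrite ?wref // woff off Emu.
Qed.

(** * Uniqueness of paths in deterministic networks *)

Lemma zstep_deterministic b q (Z : set (lval R N)) q1 Z1 q2 Z2 :
  deterministic N -> zstep b q Z q1 Z1 -> zstep b q Z q2 Z2 ->
  q1 = q2 /\ Z1 = Z2.
Proof.
move=> det [e1 [[s1 o1] ->]] [e2 [[s2 o2] ->]].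
(* The two families may differ outside [dom N b], but the target state, the resets and the guard
   zone do not see those values. *)
have e12 p : p \in dom N b -> e1 p = e2 p.
  move=> pb; have [t1 a1 r1 _] := s1 p pb; have [t2 a2 r2 _] := s2 p pb.
  by apply: det; rewrite ?a1 ?r1.
split.
  apply/functional_extensionality_dep => p; case: (boolP (p \in dom N b)) => pb.
    have [_ _ _ <-] := s1 p pb; have [_ _ _ <-] := s2 p pb.
    by rewrite e12.
  by rewrite o1 // o2.
have -> : resets b e1 = resets b e2.
  apply/setP => x; rewrite !in_resets.
  by case: (boolP (tag x \in dom N b)) => //= /e12 ->.
suff -> : zone_guard (R := R) b e1 = zone_guard b e2 by [].
by apply/seteqP; split=> nu sat p pb; have := sat p pb; rewrite e12.
Qed.

Lemma zpath_deterministic u q (Z : set (lval R N)) q1 Z1 q2 Z2 :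
  deterministic N -> zpath q Z u q1 Z1 -> zpath q Z u q2 Z2 ->
  q1 = q2 /\ Z1 = Z2.
Proof.
move=> det; elim: u q Z => [|b u IH] q Z /=.
  by move=> [-> ->] [-> ->].
move=> [r1 [Y1 [s1 path1]]] [r2 [Y2 [s2 path2]]].
have [er eY] := zstep_deterministic det s1 s2; subst r2 Y2.
exact: IH path1 path2.
Qed.

End LazyRuns.

Theorem theorem24 (R : realType) (Act : finType) (k : nat) (k_gt0 : (0 < k)%N)
    (N : network Act k) (q : gstate N) (u : seq Act)
    (u_in : word_in_alphabet N u)
    (Z : set (gval R N)) (Z_zone : is_gzone Z) (Z_elapsed : time_elapsed Z) :
  let LZ : set (lval R N) := local_elapse (local_set Z) in
  [/\ (* a local zone path on u *)
      deterministic N ->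
        forall (q' : gstate N) (Z' : set (lval R N)),
          zpath q LZ u q' Z' -> MZ q Z u q' = global_set (sync Z'),
      (* no local zone path on u *)
      ~ (exists (q' : gstate N) (Z' : set (lval R N)), zpath q LZ u q' Z') ->
        forall q' : gstate N, MZ q Z u q' = set0
    & (* arbitrary networks: all the local zone paths on u to q' together *)
      forall q' : gstate N,
        MZ q Z u q' =
        \bigcup_(Z' in [set Z' | zpath q LZ u q' Z']) global_set (sync Z')].
Proof.
move=> LZ; have MZE q' := MZ_zpath (Ordinal k_gt0) q Z q' u_in.
split=> [det q' Z' path|nopath q'|//]; rewrite MZE.
  rewrite (_ : [set _ | _] = [set Z']) ?bigcup_set1 //.
  apply/seteqP; split=> [Y /= pathY|_ -> //].
  by have [] := zpath_deterministic det pathY path.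
rewrite (_ : [set _ | _] = set0) ?bigcup_set0 //.
by apply/seteqP; split=> // Y /= pathY; case: nopath; exists q', Y.
Qed.
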